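(* The following facet-defining inequality of $\mathrm{BQP}_6$, $$\begin{aligned}&1-x_1+2x_3+x_5+2X_{12}-X_{13}-3X_{23}+X_{14}+2X_{24}-2X_{34}\\&\quad-X_{15}-2X_{25}+2X_{35}-X_{45}+X_{16}+2X_{26}-2X_{36}+X_{46}-X_{56}\ \ge 0,\end{aligned}$$ cannot be represented as an Eigen-CG inequality; that is, there are no $(v_0,v)\in\mathbb{R}\times\mathbb{R}^6$ and $\lambda>0$ such that $\lambda\cdot\mathrm{E\text{-}CG}(v_0,v)$ equals the coefficient vector of this inequality (variables not displayed, namely $x_2,x_4,x_6$, have coefficient $0$, and the constant term is $1$).
   Context: $\mathrm{BQP}_n=\operatorname{conv}\{(x,X)\in\{0,1\}^{n+\binom n2}: X_{i,j}=x_ix_j,\ 1\le i<j\le n\}$ (Boolean quadric polytope). The paper takes the displayed inequality as a known facet of $\mathrm{BQP}_6$, obtained by exhaustive enumeration; the content of the claim is the non-representability. For $v_0\in\mathbb{R}$, $v\in\mathbb{R}^n$, $\mathrm{E\text{-}CG}(v_0,v)=(\alpha,\beta,\gamma)\in\mathbb{R}^{n+\binom n2+1}$ with $\alpha_i=\lceil v_i^2+2v_iv_0\rceil$ for $i\in\{1,\dots,n\}$, $\beta_{ij}=\lceil 2v_iv_j\rceil$ for $1\le i<j\le n$, $\gamma=\lfloor v_0^2\rfloor$; it is the coefficient vector of the Eigen-CG inequality $\sum_{i<j}\beta_{ij}X_{ij}+\sum_i\alpha_ix_i+\gamma\ge0$. An inequality written in the form $\sum_{i<j}b_{ij}X_{ij}+\sum_ia_ix_i+c\ge0$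 has coefficient vector $(a,b,c)$. *)

(* Defs.v *)
From mathcomp Require Import all_boot all_order all_algebra.
From mathcomp Require Import reals.

Set Implicit Arguments.
Unset Strict Implicit.
Unset Printing Implicit Defensive.

Import Order.TTheory GRing.Theory Num.Theory.
Local Open Scope ring_scope.

Definition upair (n : nat) := {p : 'I_n * 'I_n | (p.1 < p.2)%N}.

(* The space R^(n + 'C(n, 2) + 1) of coefficient vectors (a, b, c), where
   (a, b, c) stands for \sum_(i < j) b_ij X_ij + \sum_i a_i x_i + c >= 0. *)
Definition coefvec (R : realType) (n : nat) : lmodType R :=
  ('rV[R]_n * {ffun upair n -> R^o} * R^o)%type.

Definition ECG (R : realType) (n : nat) (v0 : R) (v : 'rV[R]_n) :
    coefvec R n :=
  (\row_i (Num.ceil (v 0 i ^+ 2 + 2 * v 0 i * v0))%:~R,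
   [ffun p : upair n =>
      (Num.ceil (2 * v 0 (val p).1 * v 0 (val p).2))%:~R : R^o],
   (Num.floor (v0 ^+ 2))%:~R).

(* Coefficient vectors of the single terms x_k, X_kl (k < l) and 1. The labels
   k, l are 1-based, whereas ordinals start at 0, hence the successors. *)
Definition xterm (R : realType) (n k : nat) : coefvec R n :=
  (\row_(i < n) (i.+1 == k)%:R, 0, 0).

Definition Xterm (R : realType) (n k l : nat) : coefvec R n :=
  (0,
   [ffun p : upair n =>
      (((val p).1.+1 == k) && ((val p).2.+1 == l))%:R : R^o],
   0).

Definition cterm (R : realType) (n : nat) : coefvec R n := (0, 0, 1).

Definition bqp6_ineq (R : realType) : coefvec R 6 :=
  let x := xterm R 6 in
  let X := Xterm R 6 in
  cterm R 6 - x 1 + 2 *: x 3 + x 5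
  + 2 *: X 1 2 - X 1 3 - 3 *: X 2 3 + X 1 4 + 2 *: X 2 4 - 2 *: X 3 4
  - X 1 5 - 2 *: X 2 5 + 2 *: X 3 5 - X 4 5 + X 1 6 + 2 *: X 2 6
  - 2 *: X 3 6 + X 4 6 - X 5 6.

(* Main.v *)
Require Import Defs.
From mathcomp Require Import all_boot all_order all_algebra.
From mathcomp Require Import reals.
From mathcomp Require Import ring lra.

Import Order.TTheory GRing.Theory Num.Theory.
Local Open Scope ring_scope.

(** Only seven of the coefficients are responsible: the constant term and those
of x_1, x_3, x_5, X_13, X_15, X_35.  Put m := floor (v0 ^ 2).  The constant
term gives lambda * m = 1, so m is a positive integer and the coefficients of
E-CG(v0, v) are m times those displayed.

The coefficients -1 of x_1, X_13, X_15 make v1 v0, v1 v3 and v1 v5 negative, so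
v0, v3 and v5 have a common sign.  The coefficients 2 of x_3 and 1 of x_5 then
bound the positive numbers v3 v0 and v5 v0 by m and m / 2.  Multiplying the two
bounds and dividing by v0 ^ 2 >= m yields 2 v3 v5 <= m.  But the coefficient 2
of X_35 forces 2 v3 v5 > 2 m - 1 >= m ([no_rounding_solution]). *)

Lemma mulr_gt0_common_neg (R : realDomainType) (x y z : R) :
  x * y < 0 -> x * z < 0 -> 0 < y * z.
Proof.
move=> xy_lt0 xz_lt0.
have x_neq0 : x != 0 by apply: contraTneq xy_lt0 => ->; rewrite mul0r ltxx.
have x2_gt0 : 0 < x ^+ 2 by rewrite exprn_even_gt0.
rewrite -(pmulr_rgt0 _ x2_gt0).
suff -> : x ^+ 2 * (y * z) = (x * y) * (x * z) by rewrite nmulr_rgt0.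
by ring.
Qed.

(** A ceiling equal to c encloses its argument in ]c - 1, c].  Only the side of
each enclosure that enters the sign argument or the product bound is kept, so
m may be any real at least 1. *)
Lemma no_rounding_solution (R : realFieldType) (m v0 v1 v3 v5 : R) :
  1 <= m -> m <= v0 ^+ 2 ->
  v1 ^+ 2 + 2 * v1 * v0 <= - m ->
  v3 ^+ 2 + 2 * v3 * v0 <= 2 * m ->
  v5 ^+ 2 + 2 * v5 * v0 <= m ->
  2 * v1 * v3 <= - m -> 2 * v1 * v5 <= - m ->
  2 * m - 1 < 2 * v3 * v5 -> False.
Proof.
move=> m_ge1 m_le a1 a3 a5 b13 b15 b35.
have m_gt0 : 0 < m by exact: lt_le_trans m_ge1.
have v10_lt0 : v1 * v0 < 0 by have := sqr_ge0 v1; lra.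
have v13_lt0 : v1 * v3 < 0 by lra.
have v15_lt0 : v1 * v5 < 0 by lra.
have v30_gt0 := mulr_gt0_common_neg _ _ _ _ v13_lt0 v10_lt0.
have v50_gt0 := mulr_gt0_common_neg _ _ _ _ v15_lt0 v10_lt0.
have v35_gt0 := mulr_gt0_common_neg _ _ _ _ v13_lt0 v15_lt0.
have v30_le : v3 * v0 <= m by have := sqr_ge0 v3; lra.
have v50_le : v5 * v0 <= m / 2 by have := sqr_ge0 v5; lra.
(* The product of the two bounds, with v0 ^ 2 replaced by the smaller m. *)
have v35_le : m * (v3 * v5) <= m * (m / 2).
  apply: le_trans (ler_pM (ltW v30_gt0) (ltW v50_gt0) v30_le v50_le).
  have -> : v3 * v0 * (v5 * v0) = v0 ^+ 2 * (v3 * v5) by ring.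
  by rewrite ler_pM2r.
by rewrite ler_pM2l // in v35_le; lra.
Qed.

Definition index_pair (n : nat) (i j : 'I_n) (ltij : (i < j)%N) : upair n :=
  exist (fun p : 'I_n * 'I_n => (p.1 < p.2)%N) (i, j) ltij.

Lemma bqp6_ineq_const (R : realType) : (bqp6_ineq R).2 = 1.
Proof. by rewrite /= !(scaler0, subr0, addr0). Qed.

Lemma bqp6_ineq_linear (R : realType) (i : 'I_6) :
  (bqp6_ineq R).1.1 0 i = [:: -1; 0; 2; 0; 1; 0]`_i.
Proof. by rewrite /= !mxE; case: i => [[|[|[|[|[|[|?]]]]]] ?] //=; ring. Qed.

Lemma bqp6_ineq_X13 (R : realType) (ltij : (0 < 2)%N) :
  (bqp6_ineq R).1.2 (index_pair 6 (@Ordinal 6 0 isT) (@Ordinal 6 2 isT) ltij)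
  = -1.
Proof.
by rewrite /= !ffunE /= !scaler0 !(addr0, add0r, subr0, sub0r, oppr0).
Qed.

Lemma bqp6_ineq_X15 (R : realType) (ltij : (0 < 4)%N) :
  (bqp6_ineq R).1.2 (index_pair 6 (@Ordinal 6 0 isT) (@Ordinal 6 4 isT) ltij)
  = -1.
Proof.
by rewrite /= !ffunE /= !scaler0 !(addr0, add0r, subr0, sub0r, oppr0).
Qed.

Lemma bqp6_ineq_X35 (R : realType) (ltij : (2 < 4)%N) :
  (bqp6_ineq R).1.2 (index_pair 6 (@Ordinal 6 2 isT) (@Ordinal 6 4 isT) ltij)
  = 2.
Proof.
by rewrite /= !ffunE /= !scaler0 !(addr0, add0r, subr0, sub0r, oppr0) /GRing.scale /= mulr1.
Qed.

Theorem proposition5 (R : realType) :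
  ~ exists (v0 : R) (v : 'rV[R]_6) (lambda : R),
      0 < lambda /\ lambda *: ECG v0 v = bqp6_ineq R.
Proof.
case=> v0 [v [lambda [lambda_gt0 ECG_eq]]].
pose m : R := (Num.floor (v0 ^+ 2))%:~R.
have lambda_m : lambda * m = 1 by rewrite -(bqp6_ineq_const R) -ECG_eq.
(* As lambda = 1 / m, a rounded entry of E-CG equals m times the entry a of the
   inequality; undoing the rounding encloses its argument. *)
have unround x a :
    lambda * (Num.ceil x)%:~R = a -> m * a - 1 < x <= m * a.
  move=> <-; rewrite mulrA [m * _]mulrC lambda_m mul1r.
  by have := ceil_itv x; rewrite rmorphB.
(* A positive integer is at least 1; this is where integrality of m enters. *)
have m_ge1 : 1 <= m.
  have : 0 < m by rewrite -(pmulr_rgt0 _ lambda_gt0) lambda_m.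
  by rewrite /m ltr0z ler1z gtz0_ge1.
have m_le : m <= v0 ^+ 2 by exact: floor_le.
have alpha i : v 0 i ^+ 2 + 2 * v 0 i * v0 <= m * (bqp6_ineq R).1.1 0 i.
  suff /unround/andP[] : lambda * (Num.ceil (v 0 i ^+ 2 + 2 * v 0 i * v0))%:~R
      = (bqp6_ineq R).1.1 0 i by [].
  by rewrite -ECG_eq !mxE.
have beta (i j : 'I_6) (ltij : (i < j)%N) :
    let b := (bqp6_ineq R).1.2 (index_pair 6 i j ltij) in
    m * b - 1 < 2 * v 0 i * v 0 j <= m * b.
  by apply: unround; rewrite -ECG_eq !ffunE.
(* Ordinals start at 0, so x_1, x_3, x_5 have indices 0, 2, 4. *)
pose i1 : 'I_6 := @Ordinal 6 0 isT.
pose i3 : 'I_6 := @Ordinal 6 2 isT.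
pose i5 : 'I_6 := @Ordinal 6 4 isT.
have a1 := alpha i1; rewrite bqp6_ineq_linear /= mulrN1 in a1.
have a3 := alpha i3; rewrite bqp6_ineq_linear /= [m * 2]mulrC in a3.
have a5 := alpha i5; rewrite bqp6_ineq_linear /= mulr1 in a5.
have /andP[_ b13] := beta i1 i3 isT; rewrite bqp6_ineq_X13 mulrN1 in b13.
have /andP[_ b15] := beta i1 i5 isT; rewrite bqp6_ineq_X15 mulrN1 in b15.
have /andP[b35 _] := beta i3 i5 isT; rewrite bqp6_ineq_X35 [m * 2]mulrC in b35.
exact: no_rounding_solution m_ge1 m_le a1 a3 a5 b13 b15 b35.
Qed.
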